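(* Let $A$ be a commutative $\mathbb Q$-algebra with unit, $M$ a free $A$-module of rank $r$, and $f\in\mathrm{End}_A(M)$ with characteristic polynomial $\det(t\,\mathrm{id}_M-f)=t^r-e_1t^{r-1}+\ldots+(-1)^re_r$. Let $\{f_n\}_{n\ge 0}$ be the sequence of endomorphisms of the exterior algebra $\bigwedge M$ associated to $f$ as in the context. Then the formal power series $y(t)=\sum_{n\geq 0}f_n\frac{t^n}{n!}$ solves, in $\mathrm{End}_A(\bigwedge M)[[t]]$, the linear ODE \[ y^{(r)}(t)-e_1y^{(r-1)}(t)+\ldots+(-1)^re_r\,y(t)=0 , \] where $y^{(k)}$ denotes the $k$-th formal derivative with respect to $t$.
   Context: $\bigwedge M=\bigoplus_{j=0}^r\bigwedge^jM$ is the exterior algebra of $M$ over $A$ (with $\bigwedge^0M=A$, $\bigwedge^1M=M$). The wedge product is extended to $(\bigwedge M)[[t]]$ by $(\sum_i\alpha_it^i)\wedge(\sum_j\beta_jt^j)=\sum_{i,j}(\alpha_i\wedge\beta_j)t^{i+j}$. To $f\in\mathrm{End}_A(M)$ one associates the unique $A$-module homomorphism $\mathbf f(t)=\sum_{n\ge 0}f_nt^n:\bigwedge M\to(\bigwedge M)[[t]]$, with $f_n\in\mathrm{End}_A(\bigwedge M)$, such that $\mathbf f(t)(\alpha\wedge\beta)=\mathbf f(t)\alpha\wedge\mathbf f(t)\beta$ for all $\alpha,\beta\in\bigwedge M$, and such that the restriction of $\mathbf f(t)$ to $M$ is $\mathrm{id}_M+\sum_{n\ge 1}f^nt^n$, where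 $f^n$ is the $n$-th iterate of $f$.
   Formalization: The ODE is asserted only on the exterior powers of degree j ≥ 1, since on degree 0 it fails: y(t)1 = 1, so the left-hand side applied to 1 is (-1)^r e_r, which is nonzero in general (e.g. r = 1, f = id). *)

(* Defs.v *)
From HB Require Import structures.
From mathcomp Require Import all_boot all_order all_algebra.
(* [functions] provides the pointwise module structure on function types. *)
From mathcomp Require Import functions.

Set Implicit Arguments.
Unset Strict Implicit.
Unset Printing Implicit Defensive.

Import GRing.Theory.
Local Open Scope ring_scope.

Definition module_basis (A : comNzRingType) (M : lmodType A) (r : nat)
    (b : 'I_r -> M) : Prop :=
  forall m : M, exists! c : 'rV[A]_r, m = \sum_i c 0 i *: b i.

Definition matrix_of_endo (A : comNzRingType) (M : lmodType A) (r : nat)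
    (b : 'I_r -> M) (f : M -> M) (F : 'M[A]_r) : Prop :=
  forall j, f (b j) = \sum_i F i j *: b i.

(* [E], with [iota : M -> E], is the exterior algebra of [M] over [A]:
   the universal associative unital [A]-algebra in which [iota m * iota m = 0].
   The product of [E] is the wedge product. *)
Record is_exterior_algebra (A : comNzRingType) (M : lmodType A)
    (E : algType A) (iota : {linear M -> E}) : Prop := IsExteriorAlgebra {
  ext_square0 : forall m, iota m * iota m = 0;
  ext_lift : forall (B : algType A) (g : {linear M -> B}),
    (forall m, g m * g m = 0) ->
    exists h : {lrmorphism E -> B}, forall m, h (iota m) = g m;
  ext_lift_unique : forall (B : algType A) (h1 h2 : {lrmorphism E -> B}),
    (forall m, h1 (iota m) = h2 (iota m)) -> forall x, h1 x = h2 x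
}.

(* The [j]-th exterior power, as a submodule of [E]. *)
Definition ext_power (A : comNzRingType) (M : lmodType A) (E : algType A)
    (iota : M -> E) (j : nat) (x : E) : Prop :=
  exists s : seq (A * j.-tuple M),
    x = \sum_(p <- s) p.1 *: \prod_(m <- p.2) iota m.

(* A formal power series over [V] is its sequence of coefficients [nat -> V]. *)
Definition ps_mul (R : pzRingType) (u v : nat -> R) : nat -> R :=
  fun n => \sum_(i < n.+1) u i * v (n - i)%N.

Definition ps_deriv (V : nmodType) (u : nat -> V) : nat -> V :=
  fun n => u n.+1 *+ n.+1.

(* [f_ n] is the coefficient of [t^n] in the multiplicative map
   [E -> E[[t]]] whose restriction to [M] is [\sum_n f^n t^n]. *)
Record is_HS_extension (A : comNzRingType) (M : lmodType A) (E : algType A)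
    (iota : M -> E) (f : M -> M) (f_ : nat -> {linear E -> E}) : Prop :=
    IsHSExtension {
  HS_mul : forall x y n,
    f_ n (x * y) = ps_mul (fun k => f_ k x) (fun k => f_ k y) n;
  HS_restr : forall m n, f_ n (iota m) = iota (iter n f m)
}.

(* [\sum_n f_n t^n / n!], with coefficients in the [A]-module of maps
   [E -> E]. *)
Definition exp_series (A : comAlgType rat) (E : lmodType A)
    (f_ : nat -> {linear E -> E}) : nat -> (E -> E) :=
  fun n => ((n`!%:R : rat)^-1)%:A *: (f_ n : E -> E).

(* [y^(r) - e_1 y^(r-1) + ... + (-1)^r e_r y] *)
Definition ode_lhs (A : comNzRingType) (V : lmodType A) (r : nat)
    (e : nat -> A) (y : nat -> V) : nat -> V :=
  fun n => iter r (@ps_deriv V) y n +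
    \sum_(1 <= i < r.+1) ((-1) ^+ i * e i) *: iter (r - i) (@ps_deriv V) y n.

(* Main.v *)
(* On a product of [j >= 1] vectors, [f(t)] is the [j]-th exterior power of
   [(1 - t f)^-1], so its coordinates are [j x j] minors of [(1 - t F)^-1].
   Multiplied by [det (1 - t F)], such a minor becomes the determinant of the
   matrix [1 - t F] bordered by constant rows and columns, hence a polynomial
   of degree less than [r]. As [det (1 - t F)] is the reversed characteristic
   polynomial, this is the recurrence
   [f_(n+r) - e_1 f_(n+r-1) + ... + (-1)^r e_r f_n = 0],
   which is the differential equation read on coefficients.
   Power series are truncated: they are replaced by polynomials modulo [X^N]. *)
Require Import Defs.
From HB Require Import structures.
From mathcomp Require Import all_boot all_order all_algebra.
From mathcomp Require Import functions.
From mathcomp Require Import fingroup perm zify.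
Set Implicit Arguments.
Unset Strict Implicit.
Unset Printing Implicit Defensive.
Import GRing.Theory.
Local Open Scope ring_scope.

(** * Products of anticommuting elements *)

(** [u k] passes the [k] factors that precede it, each exchange costing a sign. *)
Lemma anticommuting_to_front (T : pzRingType) n (u : 'I_n.+1 -> T) (k : 'I_n.+1) :
  (forall i l, u i * u l = - (u l * u i)) ->
  u k * \prod_(l < n) u (lift k l) = (-1) ^+ k * \prod_(l < n.+1) u l.
Proof.
elim: n => [|n IHn] in u k * => u_anti.
  by rewrite ord1 big_ord0 big_ord1 mulr1 expr0 mul1r.
case: (unliftP ord0 k) => [k'|] ->; last first.
  by rewrite expr0 mul1r [RHS]big_ord_recl.
have lift_lift l : lift (lift ord0 k') (lift ord0 l) = lift ord0 (lift k' l).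
  by apply/val_inj; rewrite /= /bump; lia.
rewrite [in LHS]big_ord_recl [in RHS]big_ord_recl.
have -> : lift (lift ord0 k') ord0 = ord0 by apply/val_inj; rewrite /= /bump.
under eq_bigr => l _ do rewrite lift_lift.
rewrite mulrA u_anti mulNr -mulrA (IHn (u \o lift ord0)) /=; last first.
  by move=> i l; apply: u_anti.
by rewrite exprS mulN1r mulNr !mulrA -signr_odd commr_sign.
Qed.

(** Prepares an induction on permutations that removes index 0 and its image. *)
Lemma lift_perm_surj n (s : 'S_n.+1) :
  exists t : 'S_n, s = lift_perm ord0 (s ord0) t.
Proof.
(* The default [l] never occurs: [s] is injective, so [s (lift ord0 l)] differs from [s ord0]. *)
pose t l := odflt l (unlift (s ord0) (s (lift ord0 l))).
have tE l : lift (s ord0) (t l) = s (lift ord0 l).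
  rewrite /t; case: unliftP => [m ->//|/perm_inj h].
  by have := neq_lift ord0 l; rewrite h eqxx.
have t_inj : injective t.
  move=> l m /(congr1 (lift (s ord0))); rewrite !tE.
  by move=> /perm_inj /lift_inj.
exists (perm t_inj); apply/permP => i.
case: (unliftP ord0 i) => [l|] ->; last by rewrite lift_perm_id.
by rewrite lift_perm_lift permE tE.
Qed.

(** By induction the factors after the first are sorted, then [u (s ord0)] is carried to its place;
    [odd_lift_perm] counts the same signs. *)
Lemma anticommuting_prod_perm (T : pzRingType) n (u : 'I_n -> T) (s : 'S_n) :
  (forall i l, u i * u l = - (u l * u i)) ->
  \prod_(k < n) u (s k) = (-1) ^+ s * \prod_(k < n) u k.
Proof.
elim: n => [|n IHn] in u s * => u_anti.
  by rewrite !big_ord0 (_ : s = 1%g) ?odd_perm1 ?mulr1 //; apply/permP => -[].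
have [t ->] := lift_perm_surj s; set k := s ord0.
rewrite big_ord_recl lift_perm_id.
under eq_bigr => l _ do rewrite lift_perm_lift.
rewrite (IHn (u \o lift k) t) /=; last by move=> i l; apply: u_anti.
rewrite mulrA commr_sign -mulrA anticommuting_to_front // odd_lift_perm /=.
by rewrite signr_addb signr_odd mulrA commr_sign.
Qed.

Lemma prod_central_mul (R : comNzRingType) (T : nzRingType)
    (rho : {rmorphism R -> T}) n (c : 'I_n -> R) (y : 'I_n -> T) :
  (forall c x, GRing.comm (rho c) x) ->
  \prod_(k < n) (rho (c k) * y k) = rho (\prod_(k < n) c k) * \prod_(k < n) y k.
Proof.
move=> rho_central; elim: n => [|n IHn] in c y *.
  by rewrite !big_ord0 rmorph1 mulr1.
rewrite !big_ord_recl IHn rmorphM !mulrA; congr (_ * _).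
by rewrite -!mulrA; congr (_ * _); rewrite rho_central.
Qed.

(* Antisymmetrising (hence the factor [n`!]) collects the coefficients of the
   expanded product into minors of [C]. *)
Lemma anticommuting_prod_det (R : comNzRingType) (T : nzRingType)
    (rho : {rmorphism R -> T}) r n (beta : 'I_r -> T) (C : 'M[R]_(r, n)) :
  (forall c x, GRing.comm (rho c) x) ->
  (forall i l, beta i * beta l = - (beta l * beta i)) ->
  (\prod_(k < n) \sum_i rho (C i k) * beta i) *+ n`! =
  \sum_(phi : {ffun 'I_n -> 'I_r})
    rho (\det (rowsub phi C)) * \prod_(k < n) beta (phi k).
Proof.
move=> rho_central beta_anti.
pose u k := \sum_i rho (C i k) * beta i.
have u_anti k l : u k * u l = - (u l * u k).
  rewrite /u !mulr_suml -sumrN.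
  under eq_bigr => i _ do rewrite mulr_sumr.
  rewrite exchange_big /=; apply: eq_bigr => m _.
  rewrite mulr_sumr -sumrN; apply: eq_bigr => i _.
  rewrite mulrA -(mulrA _ (beta i)) -(rho_central _ (beta i)) mulrA -rmorphM.
  rewrite -mulrA beta_anti mulrN mulrC rmorphM; congr (- _).
  by rewrite !mulrA -(mulrA _ (beta m)) -(rho_central _ (beta m)) !mulrA.
transitivity (\sum_(s : 'S_n) (-1) ^+ s * \prod_(k < n) u (s k)).
  under [RHS]eq_bigr => s _ do
    rewrite anticommuting_prod_perm // mulrA -expr2 sqrr_sign mul1r.
  by rewrite sumr_const card_Sn.
under eq_bigr => s _ do rewrite bigA_distr_bigA /= mulr_sumr.
rewrite exchange_big /=; apply: eq_bigr => phi _.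
rewrite /determinant rmorph_sum mulr_suml; apply: eq_bigr => s _.
rewrite rmorphMsign -mulrA; congr (_ * _).
rewrite prod_central_mul //.
by under [in RHS]eq_bigr do rewrite mxE.
Qed.

(** * Determinants modulo a power of the variable *)

Definition eq_modXn (R : nzRingType) N (p q : {poly R}) : Prop :=
  forall k, (k < N)%N -> p`_k = q`_k.

(** Congruence modulo [X^N] respects sums, products and signs, hence the Leibniz formula. *)
Lemma eq_modXn_det (R : comNzRingType) N n (A B : 'M[{poly R}]_n) :
  (forall i k, eq_modXn N (A i k) (B i k)) -> eq_modXn N (\det A) (\det B).
Proof.
move=> AB; apply: (big_ind2 (eq_modXn N)) => // [p p' q q' pE qE k kN|s _].
  by rewrite !coefD pE ?qE.
have prodE : eq_modXn N (\prod_i A i (s i)) (\prod_i B i (s i)).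
  apply: (big_ind2 (eq_modXn N)) => // p p' q q' pE qE k kN.
  rewrite !coefM; apply: eq_bigr => i _.
  by rewrite pE ?qE //; have := ltn_ord i; lia.
by move=> k kN; rewrite !mulr_sign; case: (odd_perm s); rewrite ?coefN prodE.
Qed.

Notation "A ^%:P" := (map_mx polyC A) (at level 2, format "A ^%:P").

Definition one_subX_mx (R : comNzRingType) r (F : 'M[R]_r) : 'M[{poly R}]_r :=
  1%:M - 'X *: F^%:P.

(* A permutation cannot send the first [r] indices to themselves and also send
   one of the last [n] indices among them, so each nonzero term of the
   determinant has a constant factor among its first [r] ones. *)
Lemma size_det_bordered (R : comNzRingType) r n (F : 'M[R]_r)
    (Q : 'M[R]_(r, n)) (P : 'M[R]_(n, r)) :
  (0 < n)%N ->
  (size (\det (block_mx (one_subX_mx F) Q^%:P P^%:P 0)) <= r)%N.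
Proof.
move=> n_gt0; set B := block_mx _ _ _ _.
apply: leq_trans (size_sum _ _ _) _; apply/bigmax_leqP => s _.
rewrite mulr_sign (fun_if (fun p : {poly R} => size p)) size_polyN if_same.
pose i1 := rshift r (Ordinal n_gt0).
(* If [s i1] is one of the last columns, the factor at [i1] lies in the zero block. *)
have [i1_r|i1_r] := ltnP (s i1) r; last first.
  rewrite (bigD1 i1) //= -[s i1]splitK.
  rewrite /B; case: splitP => [i|i] iE; first by have := ltn_ord i; lia.
  by rewrite block_mxEdr mxE mul0r size_poly0.
have [i0 i0_r] : exists i0 : 'I_r, (r <= s (lshift n i0))%N.
  apply/existsP; apply: contraLR i1_r; rewrite negb_exists => /forallP s_r.
  rewrite -leqNgt.
  pose T := [set lshift n i | i : 'I_r].
  have memT i : (i \in T) = (i < r)%N.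
    apply/imsetP/idP => [[k _ ->]|i_r]; first exact: (ltn_ord k).
    by exists (Ordinal i_r) => //; apply/val_inj.
  have sT : s @: T = T.
    apply/eqP; rewrite eqEcard (card_imset _ (@perm_inj _ s)) leqnn andbT.
    apply/subsetP => _ /imsetP[_ /imsetP[i _ ->] ->].
    by rewrite memT ltnNge.
  rewrite leqNgt -memT -sT (mem_imset _ _ (@perm_inj _ s)).
  by rewrite memT /= -leqNgt leq_addr.
(* The sizes add up to at most [1 + 2 * r.-1 + n]; the bound for a product subtracts [r + n - 1],
   which leaves [r]. *)
apply: leq_trans (size_poly_prod_leq _ _) _.
rewrite card_ord big_split_ord /= (bigD1 i0) //=.
have size_const (a : R) : (size a%:P <= 1)%N by exact: size_polyC_leq1.
have top : (size (B (lshift n i0) (s (lshift n i0))) <= 1)%N.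
  rewrite -[s (lshift n i0)]splitK.
  case: splitP => [i|i] iE; first by have := ltn_ord i; lia.
  by rewrite block_mxEur mxE.
have upper :
    (\sum_(i < r | i != i0) size (B (lshift n i) (s (lshift n i))) <= 2 * r.-1)%N.
  apply: (@leq_trans (\sum_(i < r | i != i0) 2)%N).
    apply: leq_sum => i _; rewrite -[s (lshift n i)]splitK.
    case: splitP => [k|k] _; last first.
      by rewrite block_mxEur mxE (leq_trans (size_const _)).
    rewrite block_mxEul !mxE (leq_trans (size_polyD _ _)) // geq_max.
    rewrite -polyCMn (leq_trans (size_const _)) // size_polyN.
    by rewrite mulrC (leq_trans (size_polyMleq _ _)) // size_polyX addn2 ltnS.
  by rewrite sum_nat_const cardC1 card_ord mulnC.
have lower : (\sum_(i < n) size (B (rshift r i) (s (rshift r i))) <= n)%N.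
  apply: (@leq_trans (\sum_(i < n) 1)%N).
    apply: leq_sum => i _; rewrite -[s (rshift r i)]splitK.
    case: splitP => [k|k] _; first by rewrite block_mxEdl mxE.
    by rewrite block_mxEdr mxE size_poly0.
  by rewrite sum1_card card_ord.
rewrite leq_subLR.
apply: leq_ltn_trans (leq_add (leq_add top upper) lower) _.
by have := ltn_ord i0; lia.
Qed.

(* [\sum_(l < N) X^l F^l Q], i.e. [(1 - X F)^-1 Q] modulo [X^N]. *)
Fixpoint neumann_sum (R : comNzRingType) r n N (F : 'M[R]_r) (Q : 'M[R]_(r, n)) :
    'M[{poly R}]_(r, n) :=
  if N is N'.+1 then Q^%:P + 'X *: neumann_sum N' F (F *m Q) else 0.

Lemma coef_neumann_sum (R : comNzRingType) r n N (F : 'M[R]_r)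
    (Q : 'M[R]_(r, n)) i k l :
  (l < N)%N -> (neumann_sum N F Q i k)`_l = iter l (mulmx F) Q i k.
Proof.
elim: N => [|N IHN] //= in l Q *; rewrite !mxE coefD coefC coefXM.
by case: l => [|l] lN; rewrite ?addr0 // add0r iterSr IHN.
Qed.

Lemma one_subX_neumann_sum (R : comNzRingType) r n N (F : 'M[R]_r)
    (Q : 'M[R]_(r, n)) :
  one_subX_mx F *m neumann_sum N F Q =
  Q^%:P - 'X^N *: (iter N (mulmx F) Q)^%:P.
Proof.
elim: N Q => [|N IHN] Q; first by rewrite mulmx0 expr0 scale1r subrr.
rewrite mulmxDr -scalemxAr IHN iterSr exprS -scalerA scalerBr.
by rewrite mulmxBl mul1mx -scalemxAl -map_mxM addrA subrK.
Qed.

(** The column operations [U] clear the upper right block of [B] modulo [X^N], because the geometric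
    sum [S] telescopes. Hence the product agrees below [X^N] with [\det B], whose size is at most
    [r]. *)
Lemma det_one_subX_minor (R : comNzRingType) r n N (F : 'M[R]_r)
    (Q : 'M[R]_(r, n)) (P : 'M[R]_(n, r)) k :
  (0 < n)%N -> (r <= k < N)%N ->
  (\det (one_subX_mx F) * \det (P^%:P *m neumann_sum N F Q))`_k = 0.
Proof.
move=> n_gt0 /andP[rk kN]; set S := neumann_sum N F Q.
pose B := block_mx (one_subX_mx F) Q^%:P (- P)^%:P 0.
pose U : 'M[{poly R}]_(r + n) := block_mx 1%:M (- S) 0 1%:M.
have detU : \det U = 1 by rewrite det_ublock !det1 mulr1.
rewrite -(det_lblock _ (- P)^%:P).
transitivity (\det (B *m U))`_k; last first.
  by rewrite det_mulmx detU mulr1 nth_default // (leq_trans _ rk) ?size_det_bordered.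
apply: (@eq_modXn_det _ N) (kN) => i l.
rewrite mulmx_block !mulmx1 !mulmx0 !addr0 !mulmxN one_subX_neumann_sum.
rewrite map_mxN mulNmx opprK opprB subrK.
rewrite -[i]splitK -[l]splitK.
case: splitP => i' _; case: splitP => l' _ m mN.
- by rewrite !block_mxEul.
- by rewrite !block_mxEur !mxE coef0 coefXnM mN.
- by rewrite !block_mxEdl.
- by rewrite !block_mxEdr.
Qed.

(** * The reversed characteristic polynomial *)

(** [q] is [X^n p(1/X)]. The bound [n] stands in for the degree, which may drop in single terms of a
    determinant. *)
Definition reciprocal (R : nzRingType) n (p q : {poly R}) : Prop :=
  [/\ (size p <= n.+1)%N, (size q <= n.+1)%N &
      forall i, (i <= n)%N -> p`_i = q`_(n - i)].

Lemma reciprocal_linear_mul (R : comNzRingType) n (a b : R) (p q : {poly R}) :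
  reciprocal n p q ->
  reciprocal n.+1 ((a%:P + b%:P * 'X) * p) ((b%:P + a%:P * 'X) * q).
Proof.
move=> [p_n q_n pq].
have sz c d (u : {poly R}) :
    (size u <= n.+1)%N -> (size ((c%:P + d%:P * 'X) * u)%R <= n.+2)%N.
  move=> u_n; apply/leq_sizeP => i ni.
  have u0 k : (n < k)%N -> u`_k = 0.
    by move=> nk; rewrite nth_default ?(leq_trans u_n).
  case: i ni => // i ni; rewrite mulrDl coefD coefCM -mulrA coefCM coefXM /=.
  by rewrite !u0 ?mulr0 ?addr0 // ltnW.
split; [exact: sz|exact: sz|] => i ni.
rewrite !mulrDl !coefD !coefCM -!mulrA !coefCM !coefXM addrC.
case: i ni => [|i] ni.
  by rewrite subn0 /= mulr0 add0r pq // subn0 [q`_n.+1]nth_default // mulr0 add0r.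
rewrite subSS /= pq //.
(* At [i = n] both sides vanish: [p] has no coefficient of index [n.+1]. *)
suff -> : p`_i.+1 = if (n - i == 0)%N then 0 else q`_(n - i).-1 by [].
case: ifPn => ni0; first by rewrite nth_default // (leq_trans p_n) //; lia.
by rewrite pq ?subnS //; lia.
Qed.

Lemma reciprocal_linear_prod (R : comNzRingType) n (a b : 'I_n -> R) :
  reciprocal n (\prod_i ((a i)%:P + (b i)%:P * 'X))
               (\prod_i ((b i)%:P + (a i)%:P * 'X)).
Proof.
elim: n => [|n IHn] in a b *.
  by rewrite !big_ord0; split; rewrite ?size_poly1 // => -[].
by rewrite !big_ord_recl; apply: reciprocal_linear_mul.
Qed.

(** Holds term by term in the Leibniz formula: corresponding entries of the two matrices are
    [a + b X] and [b + a X]. *)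
Lemma reciprocal_char_poly (R : comNzRingType) r (F : 'M[R]_r) :
  reciprocal r (\det (one_subX_mx F)) (char_poly F).
Proof.
rewrite /char_poly /determinant.
apply: (big_ind2 (reciprocal r)) => [|p p' q q' [p_r p'_r pE] [q_r q'_r qE]|s _].
- by split; rewrite ?size_poly0 // => i _; rewrite !coef0.
- split; rewrite ?(leq_trans (size_polyD _ _)) ?geq_max ?p_r ?q_r ?p'_r ?q'_r //.
  by move=> i ir; rewrite !coefD pE ?qE.
have [p_r q_r pq] := @reciprocal_linear_prod R r
  (fun i => (i == s i)%:R) (fun i => - F i (s i)).
have -> : \prod_i one_subX_mx F i (s i) =
    \prod_i ((i == s i)%:R%:P + (- F i (s i))%:P * 'X).
  by apply: eq_bigr => i _; rewrite !mxE polyCN mulNr mulrC rmorph_nat.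
have -> : \prod_i char_poly_mx F i (s i) =
    \prod_i ((- F i (s i))%:P + (i == s i)%:R%:P * 'X).
  apply: eq_bigr => i _; rewrite !mxE polyCN addrC rmorph_nat; congr (_ + _).
  by rewrite mulr_natl.
rewrite !mulr_sign; case: (odd_perm s) => //; split; rewrite ?size_polyN //.
by move=> i ir; rewrite !coefN pq.
Qed.

(** * The recurrence on decomposable elements *)

(** Index 0 is separate because [charF] does not constrain [e 0]. *)
Lemma coef_det_one_subX (A : comNzRingType) r (F : 'M[A]_r) (e : nat -> A) i :
  char_poly F = 'X^r + \sum_(1 <= i < r.+1) ((-1) ^+ i * e i) *: 'X^(r - i) ->
  (i <= r)%N ->
  (\det (one_subX_mx F))`_i = if i == 0%N then 1 else (-1) ^+ i * e i.
Proof.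
move=> charF ir; have [_ _ -> //] := reciprocal_char_poly F.
rewrite charF coefD coefXn coef_sum.
under eq_bigr => l _ do rewrite coefZ coefXn.
case: i ir => [|i] ir.
  rewrite subn0 eqxx big_nat_cond big1 ?addr0 // => l /andP[/andP[l1 lr] _].
  by rewrite (_ : (r == r - l)%N = false) ?mulr0 //; lia.
rewrite (_ : (r - i.+1 == r)%N = false) ?add0r; last by lia.
rewrite (bigD1_seq i.+1) ?iota_uniq ?mem_index_iota ?ltnS //= eqxx mulr1.
rewrite big_nat_cond big1 ?addr0 // => l /andP[/andP[l1 lr] li].
by rewrite (_ : (r - i.+1 == r - l)%N = false) ?mulr0 //; lia.
Qed.

Lemma iter_coord (A : comNzRingType) (M : lmodType A) r (b : 'I_r -> M)
    (f : {linear M -> M}) (F : 'M[A]_r) n (Q : 'M[A]_(r, n)) k l :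
  matrix_of_endo b f F ->
  iter l f (\sum_i Q i k *: b i) = \sum_i iter l (mulmx F) Q i k *: b i.
Proof.
move=> fF; elim: l => //= l ->; rewrite linear_sum.
under [LHS]eq_bigr => i _ do rewrite linearZ /= fF scaler_sumr.
rewrite exchange_big; apply: eq_bigr => i _; rewrite mxE scaler_suml.
by apply: eq_bigr => l' _; rewrite scalerA mulrC.
Qed.

Lemma square0_anticommute (A : comNzRingType) (M : lmodType A) (E : algType A)
    (iota : {linear M -> E}) :
  (forall m, iota m * iota m = 0) ->
  forall x y, iota x * iota y = - (iota y * iota x).
Proof.
move=> sq0 x y; have := sq0 (x + y).
rewrite linearD mulrDl !mulrDr !sq0 add0r addr0 => /eqP.
by rewrite addr_eq0 => /eqP.
Qed.

(* [HS_mul] does not directly determine the image of [1], so only nonempty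
   products are considered. *)
Lemma HS_prod_coef (A : comNzRingType) (M : lmodType A) (E : algType A)
    (iota : M -> E) (f : M -> M) (f_ : nat -> {linear E -> E}) N n
    (m : 'I_n.+1 -> M) (u : 'I_n.+1 -> {poly E}) :
  is_HS_extension iota f f_ ->
  (forall k l, (l < N)%N -> (u k)`_l = iota (iter l f (m k))) ->
  forall l, (l < N)%N -> (\prod_k u k)`_l = f_ l (\prod_k iota (m k)).
Proof.
move=> fHS; elim: n => [|n IHn] in m u * => uE l lN.
  by rewrite !big_ord1 uE // (HS_restr fHS).
rewrite big_ord_recl [in RHS]big_ord_recl (HS_mul fHS) coefM.
apply: eq_bigr => i _; have il := ltn_ord i; congr (_ * _).
  by rewrite uE ?(HS_restr fHS) //; lia.
by rewrite (IHn (m \o lift ord0)) //=; [move=> k l' l'N; rewrite uE | lia].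
Qed.

Lemma map_in_alg_central (A : comNzRingType) (E : algType A) (p : {poly A})
    (q : {poly E}) :
  GRing.comm (map_poly (in_alg E) p) q.
Proof.
apply/polyP => n; rewrite coefM coefMr; apply: eq_bigr => i _.
by rewrite coef_map /= mulr_algl mulr_algr.
Qed.

(** Serves to cancel the factorial introduced by antisymmetrisation. *)
Lemma mulrn_ratalg_eq0 (A : algType rat) (V : lmodType A) (v : V) n :
  (0 < n)%N -> v *+ n = 0 -> v = 0.
Proof.
move=> n_gt0 vn0; rewrite -[v]scale1r -[1](scale1r (1 : A)).
have <- : n%:R^-1 * n%:R = 1 :> rat.
  by rewrite mulVf // Num.Theory.pnatr_eq0 -lt0n.
rewrite -scalerA -[n%:R *: 1]/(n%:R%:A) scaler_nat -mulr_algl -scalerA.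
by rewrite scaler_nat vn0 scaler0.
Qed.

Lemma HS_recurrence (A : comAlgType rat) (M : lmodType A) (r : nat)
    (b : 'I_r -> M) (f : {linear M -> M}) (F : 'M[A]_r) (e : nat -> A)
    (E : algType A) (iota : {linear M -> E}) (f_ : nat -> {linear E -> E}) n
    (m : 'I_n.+1 -> M) k :
  module_basis b -> matrix_of_endo b f F ->
  char_poly F = 'X^r + \sum_(1 <= i < r.+1) ((-1) ^+ i * e i) *: 'X^(r - i) ->
  (forall m, iota m * iota m = 0) -> is_HS_extension iota f f_ ->
  let x := \prod_i iota (m i) in
  f_ (k + r)%N x +
    \sum_(1 <= i < r.+1) ((-1) ^+ i * e i) *: f_ (k + (r - i))%N x = 0.
Proof.
move=> bP fF charF sq0 fHS x.
have [c cE] : exists c : 'I_n.+1 -> 'rV[A]_r, forall j, m j = \sum_i c j 0 i *: b i.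
  apply: (@fin_all_exists _ (fun=> 'rV[A]_r)
    (fun j v => m j = \sum_i v 0 i *: b i)) => j.
  by have [c [cE _]] := bP (m j); exists c.
(* Only coefficients up to [k + r] are read. *)
pose N := (k + r).+1.
pose Q := \matrix_(i, j) c j 0 i.
pose d := \det (one_subX_mx F).
pose rho : {rmorphism {poly A} -> {poly E}} := map_poly (in_alg E).
pose S := neumann_sum N F Q.
(* [u j] is the series of [m j] modulo [X^N], written in the basis. *)
pose u j := \sum_i rho (S i j) * (iota (b i))%:P.
have uE j l : (l < N)%N -> (u j)`_l = iota (iter l f (m j)).
  move=> lN; have -> : m j = \sum_i Q i j *: b i.
    by rewrite cE; apply: eq_bigr => i _; rewrite mxE.
  rewrite (iter_coord _ _ _ fF) linear_sum coef_sum; apply: eq_bigr => i _.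
  by rewrite coefMC coef_map /= coef_neumann_sum // mulr_algl linearZ.
have prodE := HS_prod_coef fHS uE.
have dU0 : (rho d * \prod_j u j)`_(k + r) = 0.
  apply: (@mulrn_ratalg_eq0 A E _ _ (fact_gt0 n.+1)).
  rewrite -coefMn -mulrnAr anticommuting_prod_det; last first.
  - by move=> i l; rewrite -!polyCM square0_anticommute // polyCN.
  - exact: map_in_alg_central.
  rewrite mulr_sumr coef_sum big1 // => phi _.
  rewrite mulrA -rmorphM -rmorph_prod coefMC coef_map /=.
  (* Selecting rows is multiplication by a constant matrix, which plays the role of [P] in the
     bordered determinant. *)
  have -> : rowsub phi S = (rowsub phi 1%:M)^%:P *m S.
    by rewrite map_mxsub map_mx1 mul_rowsub_mx mul1mx.
  by rewrite det_one_subX_minor ?scale0r ?mul0r // /N; lia.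
rewrite -[RHS]dU0 coefM.
rewrite -(big_mkord xpredT (fun i => (rho d)`_i * (\prod_j u j)`_(k + r - i))).
(* The convolution stops at [r], since [d] has size at most [r.+1]. *)
rewrite [RHS](@big_cat_nat _ _ _ r.+1) //= ?ltnS ?leq_addl //.
rewrite [X in _ = _ + X]big_nat_cond [X in _ = _ + X]big1 ?addr0; last first.
  move=> i /andP[/andP[ri _] _]; rewrite coef_map /= nth_default ?scale0r ?mul0r //.
  by have [d_r _ _] := reciprocal_char_poly F; apply: leq_trans ri.
rewrite [RHS]big_ltn // coef_map /= (coef_det_one_subX charF) // scale1r mul1r.
rewrite subn0 prodE //; congr (_ + _).
rewrite !big_nat; apply: eq_bigr => i /andP[i1 ir].
rewrite coef_map /= (coef_det_one_subX charF) // mulr_algl.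
rewrite prodE; last by rewrite /N; lia.
by rewrite (_ : i == 0%N = false) ?addnBA //; lia.
Qed.

(** * The differential equation *)

(** Each derivative shifts the index, and its factor [n.+1] turns 1/(n+1)! into 1/n!. *)
Lemma iter_ps_deriv_exp (A : comAlgType rat) (E : lmodType A)
    (f_ : nat -> {linear E -> E}) k n x :
  iter k (@ps_deriv _) (exp_series f_) n x =
  ((n`!%:R : rat)^-1)%:A *: f_ (n + k)%N x.
Proof.
elim: k n => [|k IHk] n /=; first by rewrite addn0.
rewrite /ps_deriv -[LHS]/((_ *+ _ : E -> E) x).
have -> (g : E -> E) l : (g *+ l) x = g x *+ l.
  by elim: l => // l IHl; rewrite !mulrS -IHl.
rewrite IHk addSnnS -scaler_nat scalerA; congr (_ *: _).
rewrite -[n.+1%:R](scaler_nat _ (1 : A)).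
rewrite -scalerAl mul1r scalerA factS natrM invfM mulrA mulfV ?mul1r //.
by rewrite Num.Theory.pnatr_eq0.
Qed.

(* The component of degree 0 is excluded: there the identity does not hold,
   since [y] fixes 1 and the left-hand side is [(-1)^r e_r]. *)
Theorem corollary1p5 (A : comAlgType rat) (M : lmodType A) (r : nat)
    (b : 'I_r -> M) (hb : module_basis b)
    (f : {linear M -> M}) (F : 'M[A]_r) (hF : matrix_of_endo b f F)
    (e : nat -> A)
    (he : char_poly F =
      'X^r + \sum_(1 <= i < r.+1) ((-1) ^+ i * e i) *: 'X^(r - i))
    (E : algType A) (iota : {linear M -> E}) (hE : is_exterior_algebra iota)
    (f_ : nat -> {linear E -> E}) (hf_ : is_HS_extension iota f f_) :
  forall (j : nat) (x : E), (0 < j)%N -> ext_power iota j x ->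
    forall n, ode_lhs r e (exp_series f_) n x = 0.
Proof.
move=> [//|j] x _ [s ->] n.
pose L x := f_ (n + r)%N x +
  \sum_(1 <= i < r.+1) ((-1) ^+ i * e i) *: f_ (n + (r - i))%N x.
have -> y : ode_lhs r e (exp_series f_) n y = ((n`!%:R : rat)^-1)%:A *: L y.
  rewrite /ode_lhs fct_sumE -[LHS]/(_ y + _ y) iter_ps_deriv_exp scalerDr.
  congr (_ + _); rewrite scaler_sumr; apply: eq_bigr => i _.
  by rewrite -[LHS]/(_ *: _ y) iter_ps_deriv_exp !scalerA mulrC.
(* By linearity of [L] it suffices to treat one product of [j.+1] vectors, where the recurrence
   applies. *)
suff -> : L (\sum_(p <- s) p.1 *: \prod_(m <- p.2) iota m) =
    \sum_(p <- s) p.1 *: L (\prod_(m <- p.2) iota m).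
  rewrite big1 ?scaler0 // => -[a t] _ /=; rewrite big_tuple.
  rewrite /L (HS_recurrence (fun i => tnth t i) n hb hF he (ext_square0 hE) hf_).
  by rewrite scaler0.
under [RHS]eq_bigr => p _ do rewrite scalerDr.
rewrite big_split /= /L linear_sum; congr (_ + _).
  by apply: eq_bigr => p _; rewrite linearZ.
under [RHS]eq_bigr => p _ do rewrite scaler_sumr.
rewrite exchange_big; apply: eq_bigr => i _.
rewrite linear_sum scaler_sumr; apply: eq_bigr => p _.
by rewrite linearZ /= !scalerA mulrC.
Qed.
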